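(* Let $\mathbb{F}_n$ be the free group on $n$ generators, $2\leq n\leq\infty$ (with $n=\infty$ meaning countably infinitely many generators), and let $\varphi:\mathbb{F}_n\to\mathbb{R}$ be a radial function, i.e., $\varphi(x)$ depends only on the word length $|x|$. If $\|e^{-t\varphi}\|_{B_2}\leq 1$ for every $t>0$, then there are constants $a,b\geq 0$ such that $$\varphi(x)\leq b+a|x|\qquad\text{for all } x\in\mathbb{F}_n.$$
   Context: $|x|$ denotes the word length of $x\in\mathbb{F}_n$ with respect to the free generators. A kernel $k:X\times X\to\mathbb{C}$ is a Schur multiplier if for every bounded operator $A=[a_{xy}]_{x,y\in X}$ on $\ell^2(X)$ the matrix $[k(x,y)a_{xy}]$ represents a bounded operator $m_k(A)$ on $\ell^2(X)$; then $\|k\|_S=\|m_k\|$. A function $\varphi:G\to\mathbb{C}$ on a discrete group $G$ is a Herz-Schur multiplier if $\hat\varphi(x,y)=\varphi(y^{-1}x)$ is a Schur multiplier on $G$, and $\|\varphi\|_{B_2}=\|\hat\varphi\|_S$. The inequality $\|\varphi\|_{B_2}\le 1$ includes the assertion that $\varphi$ is a Herz-Schur multiplier. *)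

(* Defs.v *)
From HB Require Import structures.
From mathcomp Require Import all_boot all_order all_algebra.
From mathcomp Require Import all_classical all_reals all_analysis.
From mathcomp Require Export complex.
From mathcomp Require Import ring.
Import Order.TTheory GRing.Theory Num.Theory.

Set Implicit Arguments.
Unset Strict Implicit.
Unset Printing Implicit Defensive.

(* The letter (s, false) is the generator s and (s, true) is its inverse. *)
Definition letter_inv (S : Type) (a : S * bool) : S * bool := (a.1, ~~ a.2).

Lemma letter_invK (S : Type) : involutive (@letter_inv S).
Proof. by case=> s b; rewrite /letter_inv /= negbK. Qed.

Definition reduced (S : eqType) (w : seq (S * bool)) : bool :=
  sorted (fun a b => b != letter_inv a) w.

Definition letter_mul (S : eqType) (a : S * bool) (w : seq (S * bool)) :=
  if w is b :: w' then if b == letter_inv a then w' else a :: w else [:: a].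

Section WordTheory.
Variable S : eqType.
Implicit Types (a b : S * bool) (w y z : seq (S * bool)).

Lemma letter_mul_reduced a w : reduced w -> reduced (letter_mul a w).
Proof.
case: w => [|b w] //= bw; case: ifPn => [_|ne]; last by rewrite /reduced /= ne.
exact: path_sorted bw.
Qed.

Lemma word_mul_reduced y w : reduced y -> reduced (foldr (@letter_mul S) y w).
Proof. by move=> ry; elim: w => //= a w; apply: letter_mul_reduced. Qed.

Lemma letter_mulK a w :
  reduced w -> letter_mul a (letter_mul (letter_inv a) w) = w.
Proof.
case: w => [_|b w /= bw]; first by rewrite /= eqxx.
rewrite letter_invK; have [e|ne] := eqVneq b a; last by rewrite /= eqxx.
rewrite e in bw *.
by case: w bw => [//|c w] /andP[/negPf ne _] /=; rewrite ne.
Qed.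

Lemma word_mul_letter a y w : reduced y ->
  foldr (@letter_mul S) y (letter_mul a w) =
  letter_mul a (foldr (@letter_mul S) y w).
Proof.
move=> ry; case: w => [|b w] //=; case: eqVneq => [->|//].
by rewrite letter_mulK // word_mul_reduced.
Qed.

Lemma word_mulA x y z : reduced z ->
  foldr (@letter_mul S) (foldr (@letter_mul S) z y) x =
  foldr (@letter_mul S) z (foldr (@letter_mul S) y x).
Proof. by move=> rz; elim: x => //= a x ->; rewrite word_mul_letter. Qed.

Lemma word_mul1 w : reduced w -> foldr (@letter_mul S) [::] w = w.
Proof.
elim: w => //= a w IHw aw; rewrite IHw; last exact: path_sorted aw.
by case: w aw {IHw} => //= b w /andP[/negPf ->].
Qed.

Lemma reduced_inv w : reduced w -> reduced [seq letter_inv a | a <- rev w].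
Proof.
rewrite /reduced sorted_map rev_sorted => rw.
apply: sub_sorted rw => a b /=; apply: contraNneq => e.
by rewrite (can_inj (@letter_invK S) e) letter_invK.
Qed.

Lemma word_mulKV y w : reduced y ->
  foldr (@letter_mul S) (foldr (@letter_mul S) y w)
    [seq letter_inv a | a <- rev w] = y.
Proof.
move=> ry; elim: w => //= a w IHw.
rewrite rev_cons map_rcons foldr_rcons.
have := @letter_mulK (letter_inv a) _ (word_mul_reduced w ry).
by rewrite letter_invK => ->.
Qed.

End WordTheory.

(* An element of the free group on S is its reduced word. *)
Record free_group (S : eqType) :=
  FreeGroup { word :> seq (S * bool); word_reduced : reduced word }.

HB.instance Definition _ (S : eqType) := [isSub for @word S].

Definition word_length (S : eqType) (x : free_group S) : nat := size (word x).

HB.instance Definition _ (S : choiceType) := [Choice of free_group S by <:].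

Section FreeGroupOps.
Variable S : choiceType.
Implicit Types x y z : free_group S.

Definition fg_one : free_group S := @FreeGroup S [::] isT.
Definition fg_mul x y : free_group S :=
  FreeGroup (word_mul_reduced (word x) (word_reduced y)).
Definition fg_inv x : free_group S :=
  FreeGroup (reduced_inv (word_reduced x)).

Lemma fg_mulA : associative fg_mul.
Proof. by move=> x y z; apply/val_inj/word_mulA/word_reduced. Qed.

Lemma fg_mul1 : left_id fg_one fg_mul.
Proof. by move=> x; apply/val_inj. Qed.

Lemma fg_mulr1 : right_id fg_one fg_mul.
Proof. by move=> x; apply/val_inj/word_mul1/word_reduced. Qed.

Lemma fg_mulV : left_inverse fg_one fg_inv fg_mul.
Proof.
move=> x; apply/val_inj; have := @word_mulKV S [::] (word x) isT.
by rewrite word_mul1 ?word_reduced.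
Qed.

Lemma fg_mulrV : right_inverse fg_one fg_inv fg_mul.
Proof.
move=> x; rewrite -[X in fg_mul X _](_ : fg_inv (fg_inv x) = x) ?fg_mulV //.
by apply/val_inj; rewrite /= -map_rev revK -map_comp map_id_in // => a _ /=; rewrite letter_invK.
Qed.

End FreeGroupOps.

HB.instance Definition _ (S : choiceType) :=
  isGroup.Build (free_group S) (@fg_mulA S) (@fg_mul1 S) (@fg_mulr1 S)
    (@fg_mulV S) (@fg_mulrV S).

Local Open Scope classical_set_scope.
Local Open Scope ring_scope.
Local Open Scope complex_scope.

Import Normc.

Section Ell2.
Variables (R : realType) (X : choiceType).
Local Notation C := (R[i]).

Definition ell2_mass (f : X -> C^o) : \bar R :=
  \esum_(x in [set: X]) (normc (f x) ^+ 2)%:E.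

Definition square_summable : {pred X -> C^o} :=
  fun f => `[< (ell2_mass f < +oo)%E >].

Lemma esumZ_le (c : R) (u : X -> R) : 0 <= c -> (forall x, 0 <= u x) ->
  (\esum_(x in [set: X]) (c * u x)%:E <=
   c%:E * \esum_(x in [set: X]) (u x)%:E)%E.
Proof.
move=> c0 u0; apply: ub_ereal_sup => _ [A [finA _] <-].
under eq_fsbigr do rewrite EFinM.
rewrite -ge0_mule_fsumr; last by move=> x; rewrite lee_fin.
by rewrite lee_wpmul2l ?lee_fin // ereal_sup_ubound //; exists A.
Qed.

Lemma square_summable_submod : submod_closed square_summable.
Proof.
split=> [|k f g /asboolP fs /asboolP gs]; apply/asboolP.
  by rewrite /ell2_mass esum1 // => x _; rewrite normc0 expr0n.
have n0 (z : C) : 0 <= normc z by case: z => a b; apply: sqrtr_ge0.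
have sq0 (h : X -> C^o) x : 0 <= normc (h x) ^+ 2 by rewrite sqr_ge0.
apply: (@le_lt_trans _ _
  ((2 * normc k ^+ 2)%:E * ell2_mass f + 2%:E * ell2_mass g)%E); last first.
  rewrite lte_add_pinfty //; apply: lte_mul_pinfty; rewrite ?ltry ?lee_fin ?mulr_ge0 ?sqr_ge0 //.
apply: (@le_trans _ _ (\esum_(x in [set: X])
    ((2 * normc k ^+ 2 * normc (f x) ^+ 2)%:E + (2 * normc (g x) ^+ 2)%:E))%E).
  apply: le_esum => x _; rewrite lee_fin.
  have := le_normcD (k * f x) (g x); rewrite normcM => le1.
  apply: (@le_trans _ _ ((normc k * normc (f x) + normc (g x)) ^+ 2)).
    by rewrite lerXn2r ?nnegrE ?addr_ge0 ?mulr_ge0.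
  rewrite -subr_ge0 (_ : _ - _ = (normc k * normc (f x) - normc (g x)) ^+ 2).
    exact: sqr_ge0.
  by ring.
rewrite esumD; last 2 first.
- by move=> x _; rewrite lee_fin !mulr_ge0 ?sqr_ge0.
- by move=> x _; rewrite lee_fin mulr_ge0.
by apply: leeD; apply: esumZ_le => // ; rewrite mulr_ge0 ?sqr_ge0.
Qed.

HB.instance Definition _ := GRing.isSubmodClosed.Build C (X -> C^o)
  square_summable square_summable_submod.

Record ell2 := Ell2 { ell2_fun :> X -> C^o; _ : ell2_fun \in square_summable }.

HB.instance Definition _ := [isSub for ell2_fun].
HB.instance Definition _ := [Choice of ell2 by <:].
HB.instance Definition _ := [SubChoice_isSubLmodule of ell2 by <:].

Definition ell2_norm (f : ell2) : R := Num.sqrt (fine (ell2_mass f)).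

Lemma delta_square_summable (y : X) :
  (fun x => (x == y)%:R : C^o) \in square_summable.
Proof.
apply/asboolP; rewrite /ell2_mass (_ : esum _ _ = 1%E) ?ltry //.
rewrite -(@esum_set1 R X y (fun=> 1%E)) // esum_mkcond [RHS]esum_mkcond.
apply: eq_esum => x _; rewrite in_setT.
have [->|ne] := eqVneq x y; first by rewrite mem_set // mulr1n normc1 expr1n.
by rewrite memNset ?normc0 ?expr0n //=; apply/eqP.
Qed.

Definition ell2_delta (y : X) : ell2 := Ell2 (delta_square_summable y).

Local Notation operator := {linear ell2 -> ell2}.

Definition bounded_operator (A : operator) : Prop :=
  exists M : R, forall f : ell2, ell2_norm (A f) <= M * ell2_norm f.

Definition op_norm (A : operator) : \bar R :=
  ereal_sup [set (ell2_norm (A f))%:E | f in [set f : ell2 | ell2_norm f <= 1]].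

(* The matrix coefficient a_xy = <A delta_y, delta_x>. *)
Definition matrix_coef (A : operator) (x y : X) : C :=
  (A (ell2_delta y) : ell2) x.

(* B has matrix [k(x, y) a_xy]; a bounded B is then determined by k and A, and
   is m_k(A). *)
Definition schur_product (k : X -> X -> C) (A B : operator) : Prop :=
  forall x y, matrix_coef B x y = k x y * matrix_coef A x y.

Definition schur_multiplier (k : X -> X -> C) : Prop :=
  forall A : operator, bounded_operator A ->
    exists2 B : operator, bounded_operator B & schur_product k A B.

(* The operator norm of m_k : B(ell2(X)) -> B(ell2(X)); only meaningful when
   k is a Schur multiplier. *)
Definition schur_norm (k : X -> X -> C) : \bar R :=
  ereal_sup [set op_norm B | B in [set B : operator | bounded_operator B /\
    exists A : operator,
      [/\ bounded_operator A, (op_norm A <= 1)%E & schur_product k A B]]].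

End Ell2.

Section HerzSchur.
Variables (R : realType) (G : groupType).

Definition group_kernel (phi : G -> R[i]) (x y : G) : R[i] :=
  phi (y^-1 * x)%g.

Definition herz_schur_multiplier (phi : G -> R[i]) : Prop :=
  schur_multiplier (group_kernel phi).

Definition herz_schur_norm (phi : G -> R[i]) : \bar R :=
  schur_norm (group_kernel phi).

End HerzSchur.

(* The n free generators; n = None stands for countably infinitely many. *)
Definition generators (n : option nat) : countType :=
  if n is Some m then 'I_m else nat.

Definition radial (S : choiceType) (T : Type) (phi : free_group S -> T) : Prop :=
  forall x y : free_group S, word_length x = word_length y -> phi x = phi y.

(* Main.v *)
Require Import Defs.
From HB Require Import structures.
From mathcomp Require Import all_boot all_order all_algebra.
From mathcomp Require Import all_classical all_reals all_analysis.
From mathcomp Require Import complex.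
From mathcomp Require Import ring lra zify.
Import Order.TTheory GRing.Theory Num.Theory.

Set Implicit Arguments.
Unset Strict Implicit.
Unset Printing Implicit Defensive.

Local Open Scope ring_scope.
Local Open Scope complex_scope.

(** Write phi(x) = f(|x|).  If psi_t = e^(-t phi) has Schur norm at most 1,
    then for every contraction A with a fixed unit vector w,
      sum_(x,y) w_x w_y a_xy e^(-t phi(y^-1 x)) <= 1,
    with equality at t = 0.  Comparing first orders in t turns this into the
    linear inequality sum_(x,y) w_x w_y a_xy phi(y^-1 x) >= 0.

    The contractions used here are the reflections A = 1 - 2 xi xi^* in a unit
    vector xi orthogonal to w.  Choosing w_x = (|c_x| / |c|_1)^(1/2) and
    xi_x = sgn(c_x) w_x for a finitely supported real c with zero sum gives
      2 sum_(x,y) c_x c_y phi(y^-1 x) <= |c|_1^2 phi(1)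
    (schur_semigroup_conditional): phi is conditionally of negative type, up to
    an error controlled by phi(1).

    It remains to choose c.  The points are words in two letters taken with
    positive exponents, for which |y^-1 x| is |x| + |y| minus twice the length
    of the longest common prefix.  With r = sqrt f,
    - weights 1, -(1 + t), t at the points 1, a^n, a^(n+1) give
      r(n+1) <= r(n) + K after optimizing in t, as for a function of
      negative type, where sqrt phi is subadditive (radial_sqrt_step);
    - weight -1 at the identity and a uniform distribution over the 2^N
      positive words of length N give that the average of f(2N - 2l), with l
      the common prefix length of two random words, is at most 2 f(N) + f(0).
      Here l is bounded on average (sum_lcp_bool_words), and by the Lipschitz
      property of r replacing f(2N - 2l) by f(2N) costs O(r(2N)).  Hence
      r(2N) <= sqrt 2 r(N) + O(1) (radial_double).
    The Lipschitz bound alone would allow quadratic growth of f; it is the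
    branching of the tree that lowers the doubling factor of f from 4 to 2.
    Induction on dyadic scales then yields r(n) = O(sqrt n) (radial_sqrt_bound). *)

(** * Finitely supported vectors and finite matrices on l2 *)

Section Ell2.
Local Open Scope classical_set_scope.
Import Normc.
Variables (R : realType) (X : choiceType).
Local Notation C := (R[i]).
Implicit Types (f : X -> C^o) (s : seq X).

Lemma normc_sqr (z : C) : normc z ^+ 2 = complex.Re z ^+ 2 + complex.Im z ^+ 2.
Proof. by case: z => a b; rewrite sqr_sqrtr // addr_ge0 ?sqr_ge0. Qed.

Lemma ell2_mass_ge0 f : (0 <= ell2_mass f)%E.
Proof. by apply: esum_ge0 => x _; rewrite lee_fin sqr_ge0. Qed.

Lemma sum_le_ell2_mass f s : uniq s ->
  ((\sum_(x <- s) normc (f x) ^+ 2)%:E <= ell2_mass f)%E.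
Proof.
move=> us; rewrite -sumEFin fsbig_seq //=.
by apply: ereal_sup_ubound; exists [set` s].
Qed.

Lemma ell2_mass_supp f s : uniq s -> (forall x, x \notin s -> f x = 0) ->
  ell2_mass f = (\sum_(x <- s) normc (f x) ^+ 2)%:E.
Proof.
move=> us f0; rewrite -sumEFin fsbig_seq //=.
rewrite -esum_fset //; last by move=> x _; rewrite lee_fin sqr_ge0.
rewrite [RHS]esum_mkcond; apply: eq_esum => x _.
case: ifPn => // /negP xs; rewrite f0 ?normc0 ?expr0n //.
by apply/negP => xs'; apply: xs; rewrite inE.
Qed.

Lemma finite_support_square_summable f s :
  uniq s -> (forall x, x \notin s -> f x = 0) -> f \in @square_summable R X.
Proof. by move=> us f0; apply/asboolP; rewrite (ell2_mass_supp us f0) ltry. Qed.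

Lemma ell2_mass_lty (f : ell2 R X) : (ell2_mass f < +oo)%E.
Proof. by have /asboolP := valP f. Qed.

Lemma ell2_norm_ge0 (f : ell2 R X) : 0 <= ell2_norm f.
Proof. exact: sqrtr_ge0. Qed.

Lemma ell2_norm_sqr (f : ell2 R X) : (ell2_norm f ^+ 2)%:E = ell2_mass f.
Proof.
rewrite sqr_sqrtr ?fine_ge0 ?ell2_mass_ge0 // fineK //.
by rewrite ge0_fin_numE ?ell2_mass_ge0 ?ell2_mass_lty.
Qed.

Lemma ell2_sumE (I : Type) (r : seq I) (F : I -> ell2 R X) x :
  (\sum_(i <- r) F i) x = \sum_(i <- r) (F i x : C).
Proof. by elim: r => [|i r IH]; rewrite ?big_nil // !big_cons -IH. Qed.

Section FiniteMatrix.
Variables (s : seq X) (M : X -> X -> R).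
Hypothesis us : uniq s.

Definition finite_matrix_fun (f : ell2 R X) : X -> C^o :=
  fun x => if x \in s then \sum_(y <- s) (M x y)%:C * f y else 0.

Lemma finite_matrix_fun_supp (f : ell2 R X) x :
  x \notin s -> finite_matrix_fun f x = 0.
Proof. by rewrite /finite_matrix_fun => /negPf ->. Qed.

Definition finite_matrix_op (f : ell2 R X) : ell2 R X :=
  Ell2 (finite_support_square_summable us (@finite_matrix_fun_supp f)).

Lemma finite_matrix_op_linear : linear finite_matrix_op.
Proof.
move=> a f g; apply: val_inj; apply: funext => x /=.
rewrite -[RHS]/(a * finite_matrix_fun f x + finite_matrix_fun g x).
rewrite /finite_matrix_fun; case: ifP => _; last by rewrite mulr0 addr0.
rewrite mulr_sumr -big_split /=; apply: eq_bigr => y _.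
by rewrite [X in _ * X = _](_ : _ = (a * f y + g y : C)) //; ring.
Qed.

HB.instance Definition _ :=
  GRing.isLinear.Build _ _ _ _ finite_matrix_op finite_matrix_op_linear.

Definition finite_matrix_operator : {linear ell2 R X -> ell2 R X} :=
  finite_matrix_op.

Lemma matrix_coef_finite x y : x \in s -> y \in s ->
  matrix_coef finite_matrix_operator x y = (M x y)%:C.
Proof.
move=> xs ys; rewrite /matrix_coef /= /finite_matrix_fun xs.
rewrite (bigD1_seq y) //= eqxx mulr1 big1 ?addr0 // => z /negPf ->.
by rewrite mulr0.
Qed.

Lemma ReM_sum (a : X -> R) f :
  complex.Re (\sum_(y <- s) (a y)%:C * f y) =
  \sum_(y <- s) a y * complex.Re (f y).
Proof.
elim: (s) => [|y r IH]; rewrite ?big_nil // !big_cons raddfD /= IH.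
by case: (f y) => p q /=; rewrite mul0r subr0.
Qed.

Lemma ImM_sum (a : X -> R) f :
  complex.Im (\sum_(y <- s) (a y)%:C * f y) =
  \sum_(y <- s) a y * complex.Im (f y).
Proof.
elim: (s) => [|y r IH]; rewrite ?big_nil // !big_cons raddfD /= IH.
by case: (f y) => p q /=; rewrite mul0r addr0.
Qed.

Hypothesis M_contr : forall u : X -> R,
  \sum_(x <- s) (\sum_(y <- s) M x y * u y) ^+ 2 <= \sum_(x <- s) u x ^+ 2.

(** A real matrix acts separately on real and imaginary parts, so that its
    contractivity on real vectors passes to complex ones. *)
Lemma finite_matrix_contraction (f : ell2 R X) :
  ell2_norm (finite_matrix_operator f) <= ell2_norm f.
Proof.
rewrite -(@ler_pXn2r _ 2) ?nnegrE ?ell2_norm_ge0 //.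
rewrite -lee_fin !ell2_norm_sqr.
apply: le_trans (sum_le_ell2_mass f us).
rewrite (ell2_mass_supp us (@finite_matrix_fun_supp f)) lee_fin.
under eq_big_seq => x xs do
  rewrite /= /finite_matrix_fun xs normc_sqr ReM_sum ImM_sum.
under [leRHS]eq_bigr => x _ do rewrite normc_sqr.
by rewrite !big_split /= lerD.
Qed.

End FiniteMatrix.

(** If A is the operator with matrix M on the points of s, then m_k(A) has norm
    at most 1; the sum is its coefficient <m_k(A) w, w>. *)
Lemma schur_norm_le1_test (k : X -> X -> R) s (M : X -> X -> R) (w : X -> R) :
  schur_multiplier (fun x y => (k x y)%:C) ->
  (schur_norm (fun x y => (k x y)%:C) <= 1)%E ->
  uniq s ->
  (forall u : X -> R,
    \sum_(x <- s) (\sum_(y <- s) M x y * u y) ^+ 2 <= \sum_(x <- s) u x ^+ 2) ->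
  \sum_(x <- s) w x ^+ 2 = 1 ->
  \sum_(x <- s) \sum_(y <- s) w x * w y * (k x y * M x y) <= 1.
Proof.
move=> mk nk us contr w1.
set A := finite_matrix_operator M us.
have A1 (f : ell2 R X) : ell2_norm (A f) <= ell2_norm f.
  exact: finite_matrix_contraction.
have bA : bounded_operator A by exists 1 => f; rewrite mul1r.
have [B bB AB] := mk A bA.
have nB : (op_norm B <= 1)%E.
  apply: le_trans nk; apply: ereal_sup_ubound; exists B => //; split=> //.
  exists A; split=> //; apply: ub_ereal_sup => _ [f /= f1 <-].
  by rewrite lee_fin; apply: le_trans (A1 f) f1.
pose f : ell2 R X := \sum_(y <- s) (w y)%:C *: ell2_delta R y.
have fE x : (f x : C) = if x \in s then (w x)%:C else 0.
  rewrite /f ell2_sumE; case: ifPn => xs.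
    rewrite (bigD1_seq x) //= -[LHS]/(_ * (x == x)%:R + _) eqxx mulr1.
    rewrite big1 ?addr0 // => y yx.
    by rewrite -[LHS]/(_ * (x == y)%:R) eq_sym (negPf yx) mulr0.
  rewrite big_seq big1 // => y ys.
  rewrite -[LHS]/(_ * (x == y)%:R); case: eqP => [e|]; last by rewrite mulr0.
  by rewrite e ys in xs.
have f1 : ell2_norm f <= 1.
  have : ell2_mass f = 1%E.
    rewrite (@ell2_mass_supp _ s us); last by move=> x /negPf xs; rewrite fE xs.
    rewrite -w1; congr EFin; apply: eq_big_seq => x xs.
    by rewrite fE xs normc_sqr /= expr0n addr0.
  by rewrite /ell2_norm => ->; rewrite sqrtr1.
have Bf1 : ell2_norm (B f) <= 1.
  rewrite -lee_fin; apply: le_trans nB; apply: ereal_sup_ubound.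
  by exists f.
pose b x := \sum_(y <- s) w y * (k x y * M x y).
have BfE x : x \in s -> (B f x : C) = (b x)%:C.
  move=> xs; rewrite /f linear_sum ell2_sumE /b raddf_sum.
  apply: eq_big_seq => y ys; rewrite linearZ.
  rewrite -[LHS]/((w y)%:C * matrix_coef B x y) AB matrix_coef_finite //.
  by rewrite -[RHS]/((w y * (k x y * M x y))%:C) !rmorphM mulrA.
have b1 : \sum_(x <- s) b x ^+ 2 <= 1.
  rewrite -lee_fin; apply: (@le_trans _ _ (ell2_mass (B f))); last first.
    by rewrite -ell2_norm_sqr lee_fin expr_le1 ?ell2_norm_ge0.
  apply: le_trans (sum_le_ell2_mass _ us); rewrite lee_fin.
  rewrite (eq_big_seq (fun x => normc (B f x) ^+ 2)) // => x xs.
  by rewrite BfE // normc_sqr /= expr0n addr0.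
(* The inequality 2 w b <= w^2 + b^2 replaces Cauchy-Schwarz. *)
have : \sum_(x <- s) w x * b x <= \sum_(x <- s) (w x ^+ 2 + b x ^+ 2) / 2.
  by apply: ler_sum => x _; have := sqr_ge0 (w x - b x); nra.
rewrite -mulr_suml big_split /= w1.
under eq_bigr do rewrite mulr_sumr.
under eq_bigr do under eq_bigr do rewrite mulrA.
lra.
Qed.

End Ell2.

(** * First-order consequences of contractivity *)

(** The kernels e^(-t k) with k real, for t > 0: a semigroup under pointwise
    multiplication. *)
Definition schur_contraction_semigroup (R : realType) (X : choiceType)
    (k : X -> X -> R) : Prop :=
  forall t : R, 0 < t ->
    schur_multiplier (fun x y => (expR (- (t * k x y)))%:C) /\
    (schur_norm (fun x y => (expR (- (t * k x y)))%:C) <= 1)%E.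

Section FirstOrder.
Variable R : realType.

Lemma expRN_first_order (x : R) : `|x| <= 1 / 2 ->
  `|expR (- x) - (1 - x)| <= 2 * x ^+ 2.
Proof.
rewrite ler_norml => /andP[x1 x2].
have u := expR_ge1Dx (- x); have v := expR_ge1Dx x.
have uv : expR (- x) * expR x = 1 by rewrite -expRD addNr expR0.
rewrite ler_norml; apply/andP; split; first by have := sqr_ge0 x; lra.
have h : expR (- x) * (1 + x) <= 1 by rewrite -[leRHS]uv ler_pM2l ?expR_gt0.
rewrite lerBlDr -(@ler_pM2r _ (1 + x)); last by lra.
apply: le_trans h _; rewrite -subr_ge0.
have -> : (2 * x ^+ 2 + (1 - x)) * (1 + x) - 1 = x ^+ 2 * (1 + 2 * x) by ring.
by rewrite mulr_ge0 ?sqr_ge0 //; lra.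
Qed.

(** The left side is the value at t of a function that is maximal at t = 0, so
    its right derivative there, the negative of the sum in the conclusion, is
    at most 0. *)
Lemma sum_expRN_le_first_order (I : Type) (r : seq I) (a phi : I -> R) :
  (forall t, 0 < t ->
     \sum_(i <- r) a i * expR (- (t * phi i)) <= \sum_(i <- r) a i) ->
  0 <= \sum_(i <- r) a i * phi i.
Proof.
move=> le_a; rewrite leNgt; apply/negP => neg.
set d := \sum_(i <- r) a i * phi i in neg.
pose B := \sum_(i <- r) `|phi i|.
pose K := \sum_(i <- r) `|a i| * (2 * phi i ^+ 2).
have B0 : 0 <= B by apply: sumr_ge0.
have K0 : 0 <= K.
  by apply: sumr_ge0 => i _; rewrite mulr_ge0 // mulr_ge0 ?sqr_ge0.
(* The second-order error is at most t^2 K as long as t B <= 1/2; the second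
   bound on t makes it smaller than the first-order gain - t d. *)
pose t := Num.min (1 / (2 * (B + 1))) (- d / (2 * (K + 1))).
have t0 : 0 < t.
  by rewrite lt_min !divr_gt0 //; lra.
have tB : t * B <= 1 / 2.
  have : t <= 1 / (2 * (B + 1)) by rewrite ge_min lexx.
  by rewrite ler_pdivlMr; [nra|lra].
have tK : t * K < - d.
  have : t <= - d / (2 * (K + 1)) by rewrite ge_min lexx orbT.
  by rewrite ler_pdivlMr; [nra|lra].
have := le_a t t0; rewrite leNgt => /negP; apply.
have small i : `|phi i| <= B -> a i - t * (a i * phi i) -
    t ^+ 2 * (`|a i| * (2 * phi i ^+ 2)) <= a i * expR (- (t * phi i)).
  move=> iB; have /expRN_first_order : `|t * phi i| <= 1 / 2.
    by rewrite normrM gtr0_norm //; apply: le_trans tB; rewrite ler_pM2l.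
  move=> h; have : `|a i * (expR (- (t * phi i)) - (1 - t * phi i))|
      <= `|a i| * (2 * (t * phi i) ^+ 2) by rewrite normrM ler_wpM2l.
  by rewrite ler_norml => /andP[+ _]; lra.
have inB : all (fun i => `|phi i| <= B) r.
  rewrite /B; elim: (r) => //= i q IH; rewrite big_cons lerDl sumr_ge0 //=.
  by apply: sub_all IH => j /le_trans; apply; rewrite lerDr.
have : \sum_(i <- r) a i - t * d - t ^+ 2 * K <=
    \sum_(i <- r) a i * expR (- (t * phi i)).
  rewrite /d /K !mulr_sumr -!sumrB; elim: (r) inB => [|i q IH] /=.
    by rewrite !big_nil.
  by move=> /andP[iB qB]; rewrite !big_cons lerD ?small ?IH.
apply: lt_le_trans.
have : t * (t * K) < t * - d by rewrite ltr_pM2l.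
by rewrite expr2; lra.
Qed.

End FirstOrder.

Section Conditional.
Variables (R : realType) (X : choiceType).

(** The matrix is the orthogonal reflection 1 - 2 xi xi^T. *)
Lemma reflection_contraction (s : seq X) (xi u : X -> R) : uniq s ->
  \sum_(x <- s) xi x ^+ 2 = 1 ->
  \sum_(x <- s) (\sum_(y <- s) ((x == y)%:R - 2 * xi x * xi y) * u y) ^+ 2
    <= \sum_(x <- s) u x ^+ 2.
Proof.
move=> us xi1; pose p := \sum_(y <- s) xi y * u y.
have E x : x \in s ->
    \sum_(y <- s) ((x == y)%:R - 2 * xi x * xi y) * u y = u x - 2 * xi x * p.
  move=> xs; under eq_bigr do rewrite mulrBl.
  rewrite sumrB; congr (_ - _); last first.
    by rewrite mulr_sumr; apply: eq_bigr => y _; rewrite mulrA.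
  rewrite (bigD1_seq x) //= eqxx mul1r big1 ?addr0 // => y /negPf.
  by rewrite eq_sym => ->; rewrite mul0r.
under eq_big_seq => x xs do rewrite E //.
rewrite (eq_bigr (fun x =>
  u x ^+ 2 - (4 * p * (xi x * u x) - 4 * p ^+ 2 * xi x ^+ 2))); last first.
  by move=> x _; ring.
rewrite !sumrB -!mulr_sumr xi1 -/p lerBlDr lerDl.
by rewrite (_ : _ - _ = 0) //; ring.
Qed.

(** The reflection in xi fixes w because c has zero sum, so the test inequality
    for e^(-t k) is an equality at t = 0.  Taking |w| = |xi| makes both vectors
    unit while their pointwise product is c / |c|_1; the diagonal of the
    reflection accounts for the right-hand side. *)
Lemma schur_semigroup_conditional (k : X -> X -> R) (s : seq X) (c : X -> R) :
  schur_contraction_semigroup k ->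
  uniq s -> \sum_(x <- s) c x = 0 ->
  2 * \sum_(x <- s) \sum_(y <- s) c x * c y * k x y <=
  (\sum_(x <- s) `|c x|) * \sum_(x <- s) `|c x| * k x x.
Proof.
move=> ks us c0; set S := \sum_(x <- s) `|c x|.
have S_ge0 : 0 <= S by apply: sumr_ge0.
have [S0|Sn0] := eqVneq S 0.
  have cz x : x \in s -> c x = 0.
    move=> xs; apply: normr0_eq0; apply/eqP; move/eqP: S0; rewrite psumr_eq0 //.
    by move/allP/(_ x xs).
  rewrite S0 mul0r big_seq big1 ?mulr0 // => x xs.
  by rewrite big1 // => y _; rewrite cz // !mul0r.
have S_gt0 : 0 < S by rewrite lt_neqAle eq_sym Sn0.
pose w x := Num.sqrt (`|c x| / S); pose xi x := Num.sg (c x) * w x.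
have w2 x : w x ^+ 2 = `|c x| / S by rewrite sqr_sqrtr // divr_ge0.
have wxi x : w x * xi x = c x / S.
  rewrite /xi mulrCA -expr2 w2 mulrA.
  by congr (_ / _); rewrite -numEsg.
have xi2 x : xi x ^+ 2 = `|c x| / S.
  rewrite exprMn w2; have [->|cx] := eqVneq (c x) 0.
    by rewrite normr0 mul0r mulr0.
  by rewrite sqr_sg cx mul1r.
have w1 : \sum_(x <- s) w x ^+ 2 = 1.
  by under eq_bigr do rewrite w2; rewrite -mulr_suml divff.
have xi1 : \sum_(x <- s) xi x ^+ 2 = 1.
  by under eq_bigr do rewrite xi2; rewrite -mulr_suml divff.
pose M x y : R := (x == y)%:R - 2 * xi x * xi y.
(* Testing F against the reflection: the identity part gives the diagonal, the
   rank-one part gives the quadratic form in w xi = c / S. *)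
have sumM (F : X -> X -> R) :
    \sum_(x <- s) \sum_(y <- s) w x * w y * M x y * F x y =
    \sum_(x <- s) w x ^+ 2 * F x x -
    2 * \sum_(x <- s) \sum_(y <- s) (w x * xi x) * (w y * xi y) * F x y.
  rewrite mulr_sumr -sumrB; apply: eq_big_seq => x xs.
  rewrite (eq_bigr (fun y => (x == y)%:R * (w x * w y * F x y) -
    2 * (w x * xi x * (w y * xi y) * F x y))); last first.
    by move=> y _; rewrite /M; ring.
  rewrite sumrB -mulr_sumr; congr (_ - _).
  rewrite (bigD1_seq x) //= eqxx mul1r big1 ?addr0 // => y /negPf.
  by rewrite eq_sym => ->; rewrite mul0r.
pose r := [seq (x, y) | x <- s, y <- s].
have sumr (F : X -> X -> R) :
    \sum_(p <- r) F p.1 p.2 = \sum_(x <- s) \sum_(y <- s) F x y.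
  by rewrite big_allpairs_dep.
pose a x y := w x * w y * M x y.
have a1 : \sum_(x <- s) \sum_(y <- s) a x y = 1.
  have := sumM (fun _ _ => 1); under eq_bigr do under eq_bigr do rewrite mulr1.
  move=> ->; under eq_bigr do rewrite mulr1.
  rewrite w1 (_ : \sum_(x <- s) _ = 0) ?mulr0 ?subr0 //.
  under eq_bigr do under eq_bigr do rewrite mulr1.
  under eq_bigr do rewrite -mulr_sumr.
  rewrite -mulr_suml; under eq_bigr do rewrite wxi.
  by rewrite -mulr_suml c0 !mul0r.
have : 0 <= \sum_(p <- r) a p.1 p.2 * k p.1 p.2.
  apply: sum_expRN_le_first_order => t t0.
  rewrite (sumr a) (sumr (fun x y => a x y * expR (- (t * k x y)))) a1.
  have [mk nk] := ks t t0.
  have := schur_norm_le1_test mk nk us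
    (fun u => reflection_contraction u us xi1) w1.
  apply: le_trans; apply: ler_sum => x _; apply: ler_sum => y _.
  by rewrite /a /M mulrAC mulrA.
rewrite (sumr (fun x y => a x y * k x y)) sumM.
under eq_bigr do rewrite w2 mulrAC.
under [X in _ - 2 * X]eq_bigr do under eq_bigr do rewrite !wxi.
rewrite -mulr_suml subr_ge0.
rewrite [X in 2 * X](_ : _ =
  (\sum_(x <- s) \sum_(y <- s) c x * c y * k x y) / S / S); last first.
  rewrite !mulr_suml; apply: eq_bigr => x _; rewrite !mulr_suml.
  by apply: eq_bigr => y _; ring.
by rewrite !mulrA ler_pM2r ?invr_gt0 // ler_pdivrMr // [leRHS]mulrC.
Qed.

Lemma schur_semigroup_diag_ge0 (k : X -> X -> R) (x : X) :
  schur_contraction_semigroup k ->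
  0 <= k x x.
Proof.
move=> /(_ 1 ltr01)[mk nk].
have := @schur_norm_le1_test _ _ _ [:: x] (fun _ _ => 1) (fun=> 1) mk nk isT.
rewrite !big_seq1 expr1n => /(_ _ erefl) h.
have := expR_ge1Dx (- k x x); rewrite !mul1r mulr1 in h.
suff : expR (- k x x) <= 1 by lra.
by apply: h => u; rewrite !big_seq1 mul1r.
Qed.

End Conditional.

(** * Distances between positive words *)

Section Words.
Local Open Scope nat_scope.
Variable T : eqType.
Implicit Types x y : seq T.

Fixpoint lcp_size x y : nat :=
  match x, y with
  | a :: x', b :: y' => if a == b then (lcp_size x' y').+1 else 0
  | _, _ => 0
  end.

Definition word_dist x y : nat := size x + size y - (lcp_size x y).*2.

Lemma lcp_size_refl x : lcp_size x x = size x.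
Proof. by elim: x => //= a x ->; rewrite eqxx. Qed.

Lemma lcp_size_le x y : (lcp_size x y <= minn (size x) (size y))%N.
Proof.
elim: x y => [|a x IH] [|b y] //=; case: ifP => // _.
by rewrite minnSS ltnS.
Qed.

Lemma word_distxx x : word_dist x x = 0.
Proof. by rewrite /word_dist lcp_size_refl -addnn subnn. Qed.

Lemma word_dist_nil x : word_dist x [::] = size x.
Proof. by case: x => // a x; rewrite /word_dist /= addn0 subn0. Qed.

Lemma word_distC x y : word_dist x y = word_dist y x.
Proof.
rewrite /word_dist addnC; congr (_ - _.*2).
by elim: x y => [|a x IH] [|b y] //=; rewrite eq_sym IH.
Qed.

Lemma word_dist_cat x y : word_dist x (x ++ y) = size y.
Proof.
rewrite /word_dist size_cat; suff -> : lcp_size x (x ++ y) = size x by lia.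
by elim: x => //= a x ->; rewrite eqxx.
Qed.

End Words.

Section PositiveWords.
Local Open Scope nat_scope.
Variables (S : choiceType) (T : eqType) (g : T -> S).
Hypothesis g_inj : injective g.
Implicit Types x y : seq T.

Definition positive (x : seq T) : seq (S * bool) := [seq (g i, false) | i <- x].

Lemma positive_reduced x : reduced (positive x).
Proof.
rewrite /reduced /positive; case: x => //= a x.
by elim: x a => //= b x IH a; rewrite IH andbT xpair_eqE andbF.
Qed.

Definition positive_word x : free_group S := FreeGroup (positive_reduced x).

Lemma positive_word_length x : word_length (positive_word x) = size x.
Proof. exact: size_map. Qed.

Lemma positive_word_inj : injective positive_word.
Proof. by move=> x y [] /inj_map; apply=> a b [] /g_inj. Qed.

(** An inverse letter at the head of w cannot cancel against an inverse
    positive word. *)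
Lemma foldr_inv_positive x w :
  (if w is a :: _ then a.2 else true) ->
  foldr (@letter_mul S) w [seq letter_inv a | a <- rev (positive x)] =
  [seq letter_inv a | a <- rev (positive x)] ++ w.
Proof.
elim: x w => //= i x IH w hw.
rewrite rev_cons map_rcons foldr_rcons cat_rcons -IH //.
congr foldr; case: w hw => //= [[j []] w] // _.
by rewrite xpair_eqE /= andbF.
Qed.

(** Between positive words the only cancellation in y^-1 x is that of the
    common prefix. *)
Lemma word_length_positive x y :
  word_length ((positive_word y)^-1 * positive_word x)%g = word_dist x y.
Proof.
rewrite -[LHS]/(size (foldr (@letter_mul S) (positive x)
  [seq letter_inv a | a <- rev (positive y)])).
rewrite /word_dist; elim: y x => [|j y IH] [|i x] //=.
- by rewrite addn0 size_map subn0.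
- rewrite rev_cons map_rcons foldr_rcons foldr_inv_positive //.
  by rewrite size_cat size_map size_rev size_map /=; lia.
rewrite rev_cons map_rcons foldr_rcons /= letter_invK xpair_eqE eqxx andbT.
rewrite (inj_eq g_inj); case: ifP => [_|_].
  by rewrite IH; lia.
rewrite foldr_inv_positive // size_cat size_map size_rev /= !size_map.
by rewrite subn0; lia.
Qed.

End PositiveWords.

Lemma generators_pair (n : option nat) :
  (if n is Some m then (2 <= m)%N else true) ->
  exists g : bool -> generators n, injective g.
Proof.
case: n => [m|] => [m2|_].
  exists (fun b => if b then Ordinal m2 else Ordinal (ltnW m2)).
  by case=> [] [].
by exists nat_of_bool; case=> [] [].
Qed.

(** * Common prefixes of random words *)

Fixpoint bool_words (N : nat) : seq (seq bool) :=
  if N is N'.+1 then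
    [seq true :: x | x <- bool_words N'] ++
    [seq false :: x | x <- bool_words N']
  else [:: [::]].

Lemma size_bool_words N x : x \in bool_words N -> size x = N.
Proof.
elim: N x => [|N IH] x /=; first by rewrite inE => /eqP ->.
by rewrite mem_cat => /orP[] /mapP[y /IH <- ->].
Qed.

Lemma card_bool_words N : size (bool_words N) = (2 ^ N)%N.
Proof. by elim: N => //= N IH; rewrite size_cat !size_map IH expnS; lia. Qed.

Lemma bool_words_uniq N : uniq (bool_words N).
Proof.
elim: N => //= N IH; rewrite cat_uniq.
rewrite !map_inj_uniq ?IH /= ?andbT => [|x y []|x y []] //.
by apply/hasPn => _ /mapP[x _ ->]; apply/negP => /mapP[].
Qed.

(** Two random words agree in the first letter with probability 1/2, so the
    sum T(N) satisfies T(N+1) = 2 (4^N + T(N)): the mean length of the common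
    prefix stays below 1. *)
Lemma sum_lcp_bool_words N :
  (\sum_(x <- bool_words N) \sum_(y <- bool_words N) lcp_size x y <= 4 ^ N)%N.
Proof.
elim: N => [|N IH]; first by rewrite !big_seq1.
have card : (\sum_(x <- bool_words N) \sum_(y <- bool_words N) 1 = 4 ^ N)%N.
  rewrite sum1_size big_const_seq count_predT card_bool_words iter_addn_0.
  by rewrite -expnMn.
rewrite /= big_cat !big_map /= (eq_bigr (fun x =>
  \sum_(y <- bool_words N) (1 + lcp_size x y)))%N; last first.
  by move=> x _; rewrite big_cat !big_map /= [X in (_ + X)%N]big1 ?addn0.
rewrite [X in (_ + X)%N](eq_bigr (fun x =>
  \sum_(y <- bool_words N) (1 + lcp_size x y)))%N; last first.
  by move=> x _; rewrite big_cat !big_map /= big1.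
under eq_bigr do rewrite big_split.
rewrite big_split /= card expnS; lia.
Qed.

(** * Growth of radial functions of negative type *)

Section Growth.
Variables (R : realType) (f : nat -> R).
Hypothesis f0_ge0 : 0 <= f 0.
Hypothesis f_cond : forall (s : seq (seq bool)) (c : nat -> R), uniq s ->
  \sum_(x <- s) c (size x) = 0 ->
  2 * \sum_(x <- s) \sum_(y <- s) c (size x) * c (size y) * f (word_dist x y)
  <= (\sum_(x <- s) `|c (size x)|) ^+ 2 * f 0.

Local Notation ray n := (nseq n true).

Lemma radial_ge0 n : 0 <= f n.
Proof.
case: n => // n.
pose c (k : nat) : R := if k == 0%N then 1 else -1.
have := @f_cond [:: [::]; ray n.+1] c isT.
rewrite !big_cons !big_nil /c /= !addr0 subrr => /(_ erefl).
rewrite word_dist_nil word_distC word_dist_nil !word_distxx /= size_nseq.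
rewrite normr1 normrN normr1; nra.
Qed.

(** A function of negative type is a squared Hilbert space distance, whose
    square root r is the natural quantity. *)
Let r n := Num.sqrt (f n).
Let r_ge0 n : 0 <= r n. Proof. exact: sqrtr_ge0. Qed.
Let sqr_r n : r n ^+ 2 = f n. Proof. by rewrite sqr_sqrtr ?radial_ge0. Qed.
(** A Lipschitz constant of r; being at least 1 and f(0), it also bounds the
    additive errors of the doubling step by its multiples. *)
Let K := 1 + f 1 + 2 * f 0.

(** The condition at the points 1, a^(n+1), a^(n+2) with weights
    1, -(1 + t), t. *)
Lemma radial_step (n : nat) (t : R) : 0 < t ->
  t * f n.+2 <= (1 + t) * f n.+1 + t * (1 + t) * f 1 + (1 + t) ^+ 2 * f 0.
Proof.
move=> t0; pose c (k : nat) : R :=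
  if k == 0%N then 1 else if k == n.+1 then - (1 + t) else t.
have us : uniq [:: [::]; ray n.+1; ray n.+2].
  rewrite /= !inE /= andbT; apply/eqP => -[/(congr1 size)].
  by rewrite /= !size_nseq => /eqP; rewrite ltn_eqF.
have := @f_cond _ c us.
rewrite !big_cons !big_nil !size_nseq /c !eqxx /= eqSS gtn_eqF // !addr0.
have z0 : 1 + (- (1 + t) + t) = 0 by ring.
move=> /(_ z0).
have d1 : word_dist (ray n.+1) (ray n.+2) = 1%N.
  by rewrite -[in n.+2](addn1 n.+1) nseqD word_dist_cat.
rewrite !word_distxx !(word_distC [::]) !word_dist_nil.
rewrite (word_distC (_ :: _ :: _)) [word_dist _ _]d1 /= !size_nseq.
rewrite normr1 normrN !gtr0_norm //; last lra.
have : 0 <= t * f 0 by rewrite mulr_ge0 // ltW.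
have : 0 <= t ^+ 2 * f 0 by rewrite mulr_ge0 ?sqr_ge0.
have := f0_ge0; lra.
Qed.

Let K_ge1 : 1 <= K.
Proof. by rewrite /K; have := radial_ge0 1; have := radial_ge0 0; lra. Qed.

(** The optimal parameter of the three-point inequality is of order r(n); the
    shift by 1 keeps it positive and bounds 1 + t by 2 t. *)
Lemma radial_sqrt_step n : r n.+1 <= r n + K.
Proof.
have f1 := radial_ge0 1; have f0 := radial_ge0 0.
have K1 := K_ge1.
rewrite -(@ler_pXn2r _ 2) ?nnegrE ?addr_ge0 // ?sqr_r; last by lra.
case: n => [|n].
  by have := r_ge0 0; have := sqr_ge0 (r 0); rewrite /K; nra.
have t0 : 0 < r n.+1 + 1 by have := r_ge0 n.+1; lra.
rewrite -(ler_pM2l t0); apply: le_trans (radial_step n t0) _.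
rewrite -sqr_r; have := r_ge0 n.+1; move: (r n.+1) => u u0.
have e : (1 + (u + 1)) ^+ 2 * f 0 <= 2 * (u + 1) * (1 + (u + 1)) * f 0.
  rewrite ler_wpM2r // -subr_ge0 (_ : _ - _ = (u + 2) * u); last by ring.
  by rewrite mulr_ge0 //; lra.
(* A lower bound for the difference of the two sides, obtained from e. *)
have p : 0 <= (u + 1) * (u * K + (K - 1) ^+ 2 + 1) + u.
  rewrite addr_ge0 // mulr_ge0 ?addr_ge0 ?sqr_ge0 ?mulr_ge0 //.
  lra.
rewrite -subr_ge0; apply: le_trans p _; rewrite -subr_ge0.
have -> : f 1 = K - 1 - 2 * f 0 by rewrite /K; ring.
lra.
Qed.

Lemma radial_sqrt_lip n j : r (n + j) <= r n + K * j%:R.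
Proof.
elim: j => [|j IH]; first by rewrite addn0 mulr0 addr0.
by have := radial_sqrt_step (n + j); rewrite addnS mulrS; lra.
Qed.

(** The condition with weight -1 at the identity and 2^-N at each positive word
    of length N. *)
Lemma radial_sphere N : (0 < N)%N ->
  (4 ^- N) * \sum_(x <- bool_words N) \sum_(y <- bool_words N) f (word_dist x y)
  <= 2 * f N + f 0.
Proof.
move=> N0; pose c (k : nat) : R := if k == 0%N then -1 else 2 ^- N.
have us : uniq ([::] :: bool_words N).
  rewrite /= bool_words_uniq andbT; apply/negP => /size_bool_words N0'.
  by rewrite -N0' in N0.
have cN x : x \in bool_words N -> c (size x) = 2 ^- N.
  by move=> /size_bool_words ->; rewrite /c gtn_eqF.
have sumc (a : R) : \sum_(x <- bool_words N) 2 ^- N * a = a.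
  rewrite big_const_seq count_predT card_bool_words iter_addr_0.
  by rewrite -(mulr_natl (_ * a)) natrX mulrA mulfV ?mul1r // expf_neq0.
have sumcN (F : seq bool -> R) a : (forall x, x \in bool_words N -> F x = a) ->
    \sum_(x <- bool_words N) c (size x) * F x = a.
  move=> Fa; rewrite -[RHS]sumc; apply: eq_big_seq => x xN.
  by rewrite cN // Fa.
have absc : \sum_(x <- bool_words N) `|c (size x)| = 1.
  rewrite -[RHS]sumc; apply: eq_big_seq => x xN.
  by rewrite cN // mulr1 ger0_norm // invr_ge0 exprn_ge0.
have := @f_cond _ c us.
rewrite !big_cons [c (size [::])]/c /=.
rewrite (eq_big_seq (fun=> 2 ^- N * 1)) => [|x xN]; last by rewrite cN // mulr1.
rewrite sumc addNr => /(_ erefl).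
rewrite absc normrN normr1 word_distxx.
rewrite (eq_bigr (fun x => c (size x) * (- f (word_dist [::] x)))); last first.
  by move=> x _; rewrite mulN1r mulNr mulrN.
rewrite (sumcN _ (- f N)); last first.
  by move=> x /size_bool_words xN; rewrite word_distC word_dist_nil xN.
rewrite (eq_big_seq (fun x => c (size x) * (- f N) + 4 ^- N *
  \sum_(y <- bool_words N) f (word_dist x y))); last first.
  move=> x xN; rewrite big_cons word_dist_nil (size_bool_words xN) /c /=.
  rewrite gtn_eqF // mulrN1 mulNr -mulrN; congr (_ + _).
  rewrite mulr_sumr; apply: eq_big_seq => y yN.
  rewrite (size_bool_words yN) gtn_eqF // -invfM -exprMn.
  by congr (_ ^- _ * _); ring.
rewrite big_split /= (sumcN _ (- f N)) // -mulr_sumr.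
lra.
Qed.

(** Replacing f(2N - 2l) by f(2N) in radial_sphere costs at most 4 K l r(2N),
    which on average is at most 4 K r(2N); completing the square gives
    (r(2N) - 2 K)^2 <= 2 r(N)^2 + f(0) + 4 K^2. *)
Lemma radial_double N : r N.*2 <= Num.sqrt 2 * r N + 5 * K.
Proof.
have K1 := K_ge1; have r0 := r_ge0 N; have s0 : 0 <= Num.sqrt (2 : R) by [].
have s2 : Num.sqrt (2 : R) ^+ 2 = 2 by rewrite sqr_sqrtr.
have s1 : 1 <= Num.sqrt (2 : R).
  by rewrite -(@ler_pXn2r _ 2) ?nnegrE // s2 expr1n; lra.
case: N r0 => [|N] r0; first by have := ler_peMl r0 s1; rewrite double0; lra.
set M := N.+1 in r0 *; set R2 := r M.*2.
have dist_ge x y : x \in bool_words M -> y \in bool_words M ->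
    R2 ^+ 2 - (4 * K * R2) * (lcp_size x y)%:R <= f (word_dist x y).
  move=> /size_bool_words sx /size_bool_words sy.
  have := lcp_size_le x y; rewrite sx sy minnn => le.
  have := radial_sqrt_lip (word_dist x y) (lcp_size x y).*2.
  rewrite (_ : (_ + _)%N = M.*2); last by rewrite /word_dist sx sy; lia.
  rewrite -/R2 -sqr_r -mul2n natrM; have := r_ge0 (word_dist x y).
  have : (0 : R) <= (lcp_size x y)%:R by [].
  have : 0 <= R2 by exact: r_ge0.
  move: (r _) (_%:R) => u l R0 l0 u0 h.
  have z0 : 0 <= K * l by rewrite mulr_ge0 // (le_trans ler01).
  have zR := mulr_ge0 z0 R0.
  (* If R2 is below the Lipschitz loss, the left side is already at most 0. *)
  have [le_R|lt_R] := lerP R2 (2 * (K * l)).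
    by have := ler_wpM2r R0 le_R; have := sqr_ge0 u; rewrite -expr2; lra.
  have : (R2 - 2 * (K * l)) ^+ 2 <= u ^+ 2.
    by rewrite ler_pXn2r ?nnegrE //; lra.
  by have := sqr_ge0 (K * l); rewrite sqrrB; lra.
have := radial_sphere (ltn0Sn N); rewrite -/M.
have : 4 ^- M * \sum_(x <- bool_words M) \sum_(y <- bool_words M)
    (R2 ^+ 2 - (4 * K * R2) * (lcp_size x y)%:R) <=
  4 ^- M * \sum_(x <- bool_words M) \sum_(y <- bool_words M) f (word_dist x y).
  rewrite ler_wpM2l ?invr_ge0 ?exprn_ge0 //.
  rewrite big_seq [leRHS]big_seq; apply: ler_sum => x xM.
  rewrite big_seq [leRHS]big_seq; apply: ler_sum => y yM.
  exact: dist_ge.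
move=> /le_trans/[apply].
under eq_bigr do rewrite sumrB -[X in _ - X]mulr_sumr.
rewrite sumrB -[X in _ - X]mulr_sumr.
have -> : \sum_(x <- bool_words M) \sum_(y <- bool_words M) R2 ^+ 2 =
    4 ^+ M * R2 ^+ 2.
  rewrite !big_const_seq !count_predT card_bool_words !iter_addr_0 -mulrnA.
  by rewrite -[LHS]mulr_natl -expnMn natrX.
have := sum_lcp_bool_words M; rewrite -(ler_nat R) natr_sum natrX.
under eq_bigr do rewrite natr_sum.
set L := (X in X <= _) => hL.
rewrite mulrBr mulrA mulVf ?expf_neq0 // mul1r mulrCA.
have L1 : 4 ^- M * L <= 1 by rewrite mulrC ler_pdivrMr ?exprn_gt0 // mul1r.
have R20 : 0 <= R2 by exact: r_ge0.
have : 4 * K * R2 * (4 ^- M * L) <= 4 * K * R2 * 1.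
  by rewrite ler_wpM2l // !mulr_ge0 //; lra.
rewrite -sqr_r -/L => h1 h2.
have fK : f 0 <= K by rewrite /K; have := radial_ge0 1; have := f0_ge0; lra.
rewrite leNgt; apply/negP => h3.
have : (Num.sqrt 2 * r M + 3 * K) ^+ 2 < (R2 - 2 * K) ^+ 2.
  rewrite ltrXn2r ?nnegrE //; try lra; have := mulr_ge0 s0 r0; lra.
rewrite !sqrrD exprMn s2.
have := mulr_ge0 s0 r0; have : K <= K * K by rewrite ler_peMl //; lra.
have := mulr_ge0 (le_trans ler01 K1) (mulr_ge0 s0 r0).
rewrite sqrrN; lra.
Qed.

Lemma radial_half n : r n <= Num.sqrt 2 * r n./2 + 6 * K.
Proof.
have := radial_double n./2; have := K_ge1; rewrite -{3}(odd_double_half n).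
case: (odd n); rewrite ?add0n; last by lra.
by rewrite add1n; have := radial_sqrt_step n./2.*2; lra.
Qed.

(** The negative constant makes the induction close: it must absorb the
    error 6 K at each halving, which needs 24 (sqrt 2 - 1) >= 6, and the
    leading constant 25 then fits n = 1. *)
Lemma radial_sqrt_bound n : r n.+1 <= 25 * K * Num.sqrt n.+1%:R - 24 * K.
Proof.
have K1 := K_ge1.
have s2 : 5 / 4 <= Num.sqrt (2 : R).
  by rewrite -(@ler_pXn2r _ 2) ?nnegrE // ?sqr_sqrtr //; lra.
elim/ltn_ind: n => -[_|n IH].
  rewrite sqrtr1 mulr1 (_ : _ - _ = K); last by ring.
  rewrite -(@ler_pXn2r _ 2) ?nnegrE // ?sqr_r; last by lra.
  have f1_le : f 1 <= K by rewrite /K; have := f0_ge0; lra.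
  by have : K <= K * K; [rewrite ler_peMl //; lra|rewrite expr2; lra].
have hn : (n.+2./2 = n./2.+1)%N by [].
have lt_n : (n./2 < n.+1)%N by rewrite ltnS; lia.
have := radial_half n.+2; rewrite hn.
have := IH _ lt_n; rewrite -(@ler_pM2l _ (Num.sqrt 2)) ?sqrtr_gt0 //.
have : Num.sqrt 2 * Num.sqrt (n./2.+1)%:R <= Num.sqrt n.+2%:R :> R.
  rewrite -sqrtrM // -natrM ler_sqrt ?ltr0n // ler_nat; lia.
move: (Num.sqrt n.+2%:R) (Num.sqrt (n./2.+1)%:R) => a b h.
have : K * (Num.sqrt 2 * b) <= K * a by rewrite ler_pM2l //; lra.
have : K * (5 / 4) <= K * Num.sqrt 2 by rewrite ler_pM2l //; lra.
lra.
Qed.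

Lemma radial_linear_growth :
  exists a b : R, [/\ 0 <= a, 0 <= b & forall n, f n <= b + a * n%:R].
Proof.
exists ((25 * K) ^+ 2), (f 0); split=> //; first exact: sqr_ge0.
case=> [|n]; first by rewrite mulr0 addr0.
apply: ler_wpDl => //; rewrite -sqr_r -[n.+1%:R]sqr_sqrtr // -exprMn.
have K1 := K_ge1.
rewrite ler_pXn2r ?nnegrE ?mulr_ge0 //; try lra.
by have := radial_sqrt_bound n; lra.
Qed.

End Growth.

Theorem theorem1p6 (R : realType) (n : option nat)
    (n_ge2 : if n is Some m then (2 <= m)%N else true)
    (phi : free_group (generators n) -> R)
    (phi_radial : radial phi)
    (phi_schur : forall t : R, 0 < t ->
      let psi := fun x => (expR (- (t * phi x)))%:C in
      herz_schur_multiplier psi /\ (herz_schur_norm psi <= 1)%E) :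
  exists a b : R, [/\ 0 <= a, 0 <= b &
    forall x, phi x <= b + a * (word_length x)%:R].
Proof.
have [g g_inj] := generators_pair n_ge2.
pose f k := phi (positive_word g (nseq k true)).
have fE x : phi x = f (word_length x).
  by apply: phi_radial; rewrite positive_word_length size_nseq.
pose k x y := phi (y^-1 * x)%g.
have f0 : 0 <= f 0.
  suff : 0 <= k 1%g 1%g by rewrite /k mulg1 invg1 fE.
  exact: schur_semigroup_diag_ge0.
suff [a [b [a0 b0 fb]]] : exists a b : R,
    [/\ 0 <= a, 0 <= b & forall n, f n <= b + a * n%:R].
  by exists a, b; split=> // x; rewrite fE.
apply: radial_linear_growth => // s c us c0.
pose c' (x : free_group (generators n)) := c (word_length x).
have := @schur_semigroup_conditional R _ k [seq positive_word g x | x <- s] c'.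
rewrite !big_map.
under eq_bigr do rewrite /c' positive_word_length.
move=> /(_ phi_schur); rewrite map_inj_uniq; last exact: positive_word_inj.
move=> /(_ us c0).
under eq_bigr => x _.
  rewrite big_map /k; under eq_bigr do
    rewrite fE word_length_positive // /c' !positive_word_length.
  over.
move=> /le_trans; apply.
under eq_bigr do rewrite /c' positive_word_length.
under [X in _ * X]eq_bigr do
  rewrite /k fE word_length_positive // word_distxx /c' positive_word_length.
by rewrite -mulr_suml mulrA expr2.
Qed.
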